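(* Let $n,N\in\mathbb{N}$ and $a\in\mathbb{R}^{n\times N}$. Let $G$ be a (nonempty) collection of maps from $I=\{1,\dots,n\}$ to $J=\{1,\dots,N\}$, let $\mathbb{P}$ be the normalized counting measure on $G$, and let $C_G>0$ be a constant depending only on $G$. Assume that for all $i\in I$, $j\in J$ and all different pairs $(i_1,j_1),(i_2,j_2)\in I\times J$: (i) $\mathbb{P}(\{g\in G: g(i)=j\})=1/N$, (ii) $\mathbb{P}(\{g\in G: g(i_1)=j_1,\ g(i_2)=j_2\})\le C_G/N^2$. Then, for every integer $\ell$ with $1\le\ell\le n$, $$\frac{c}{N}\sum_{j=1}^{\ell N}s(j)\ \le\ \int_G\sum_{k=1}^{\ell}\operatorname*{k\text{-}max}_{1\le i\le n}|a_{ig(i)}|\,d\mathbb{P}(g)\ \le\ \frac{C}{N}\sum_{j=1}^{\ell N}s(j),$$ where $1/c=48(1+2C_G)^2$ and $C=6(1+2C_G)$.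
   Context: For real numbers $y_1,\dots,y_n$, $\operatorname{k-max}_{1\le i\le n}y_i$ denotes the $k$-th largest value among $y_1,\dots,y_n$ (counted with multiplicity). For $1\le j\le nN$, $s(j)$ is the $j$-th largest entry (counted with multiplicity) of the matrix $(|a_{ij}|)_{i,j}$ of absolute values of $a$. *)

(* Defs.v *)
From mathcomp Require Import all_boot all_order all_algebra.
From mathcomp Require Import reals.
Set Implicit Arguments.
Unset Strict Implicit.
Unset Printing Implicit Defensive.
Import Order.TTheory GRing.Theory Num.Theory.
Local Open Scope ring_scope.

(* k is 1-based: meaningful for 1 <= k <= #|I|, with repeated values counted
   with multiplicity since the sorted sequence keeps them all. *)
Definition kmax (R : realType) (I : finType) (k : nat) (y : I -> R) : R :=
  nth 0 (sort >=%R [seq y i | i : I]) k.-1.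

Definition entry_rearr (R : realType) (n N : nat) (a : 'M[R]_(n, N))
    (j : nat) : R :=
  kmax j (fun p : 'I_n * 'I_N => `|a p.1 p.2|).

(* Normalized counting measure on a finite set G, and the integral against it.
   Both are 0 for empty G. *)
Definition counting_prob (R : realType) (T : finType) (G : {set T})
    (E : pred T) : R :=
  #|[set g in G | E g]|%:R / #|G|%:R.

Definition counting_integral (R : realType) (T : finType) (G : {set T})
    (f : T -> R) : R :=
  (\sum_(g in G) f g) / #|G|%:R.

(* Main.v *)
(** Write [top l y] for the sum of the [l] largest values of [y >= 0]. If [t] is
    the [l]-th largest value then [top l y = l t + \sum_i (y_i - t)^+]; it is the
    minimum of this expression over [t] and the maximum of [\sum_i w_i y_i] over
    weights [0 <= w_i <= 1] of total mass at most [l].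

    Upper bound: average [top l y <= l t + \sum_i (y_i - t)^+] over [g], where
    [t = s(l N)]; by (i) the right-hand side has mean [(\sum_(j <= l N) s(j)) / N].

    Lower bound: let [T] be the positions of the [l N] largest entries, [X g] the
    number of points of the graph of [g] in [T], and [b = (1 + 2 C_G)^-1]. Since
    [b x - (b x)^2 / (4 l) <= l], the weights [b - b^2 X / (4 l)] on the part of
    the graph in [T] are admissible as soon as they are nonnegative. Averaging the
    resulting bound only involves the second moments controlled by (ii). *)

Require Import Defs.
From mathcomp Require Import all_boot all_order all_algebra.
From mathcomp Require Import reals.
From mathcomp Require Import ring lra.
Import Order.TTheory GRing.Theory Num.Theory.
Local Open Scope ring_scope.

Definition top_sum {R : realType} {I : finType} (l : nat) (y : I -> R) : R :=
  \sum_(1 <= k < l.+1) kmax k y.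

(** Sorting the indices rather than the values breaks ties, so the first [l] of them form a set of
    exactly [l] elements; [t] is the value at the last of these. *)
Lemma top_sum_attained (R : realType) (I : finType) (l : nat) (y : I -> R) :
    (forall i, 0 <= y i) -> (0 < l <= #|I|)%N ->
  exists (T : {set I}) (t : R), [/\ 0 <= t, #|T| = l,
    forall i, i \in T -> t <= y i, forall i, i \notin T -> y i <= t
    & top_sum l y = \sum_(i in T) y i].
Proof.
move=> y0 /andP[l0 lI].
pose s := sort (relpre y >=%R) (enum I).
have sE : sort >=%R [seq y i | i : I] = map y s by rewrite /image_mem sort_map.
have szs : size s = #|I| by rewrite size_sort -cardE.
have us : uniq s by rewrite sort_uniq enum_uniq.
have ss : sorted >=%R (map y s).
  by rewrite -sE; apply: sort_sorted => u v; exact: le_total.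
have ms i : i \in s by rewrite mem_sort mem_enum.
have ge_nth j k : (j <= k)%N -> (k < #|I|)%N ->
    nth 0 (map y s) k <= nth 0 (map y s) j.
  move=> jk kI.
  by apply: (sorted_leq_nth (rev_trans le_trans) _ 0 ss) => //;
    rewrite inE size_map szs // (leq_ltn_trans jk).
have yE i : y i = nth 0 (map y s) (index i s).
  by rewrite (nth_map i) ?index_mem ?nth_index.
have l1I : (l.-1 < #|I|)%N by rewrite prednK.
exists [set i in take l s], (nth 0 (map y s) l.-1); split.
(* [nth_map] needs some index as default value; [I] is nonempty because [l.-1 < #|I|]. *)
- by case: (set_0Vmem [set: I]) => [I0|[i _]];
    [move: l1I; rewrite -cardsT I0 cards0 | rewrite (nth_map i) ?szs].
- rewrite cardsE; have /card_uniqP -> : uniq (take l s) by exact: take_uniq.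
  by rewrite size_takel ?szs.
- move=> i; rewrite inE in_take // => ils.
  by rewrite yE ge_nth // -ltnS prednK.
- move=> i; rewrite inE in_take // -leqNgt => lis.
  by rewrite yE ge_nth // ?(leq_trans (leq_pred _) lis) // -szs index_mem.
- rewrite /top_sum big_add1 /= /kmax sE.
  under [RHS]eq_bigl do rewrite inE.
  rewrite -big_uniq ?take_uniq //=.
  rewrite -[RHS](big_map y xpredT id) map_take [RHS](big_nth 0) size_takel ?size_map ?szs //.
  by apply: eq_big_nat => k /andP[_ kl]; rewrite nth_take.
Qed.

(** On [T] each [y i] equals [t] plus its positive excess; off [T] the excess vanishes. *)
Lemma top_sum_threshold (R : realType) (I : finType) (l : nat) (y : I -> R)
    (T : {set I}) (t : R) :
    #|T| = l -> (forall i, i \in T -> t <= y i) ->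
    (forall i, i \notin T -> y i <= t) ->
  \sum_(i in T) y i = l%:R * t + \sum_i Num.max 0 (y i - t).
Proof.
move=> cT yT yN; rewrite [in RHS](bigID (mem T)) /= [X in _ + (_ + X)]big1 ?addr0.
  rewrite mulr_natl -cT -sumr_const -big_split /=.
  by apply: eq_bigr => i /yT ty; rewrite max_r ?subr_ge0 // addrC subrK.
by move=> i /yN ty; rewrite max_l ?subr_le0.
Qed.

(** Here [t] is arbitrary, so that one threshold can serve all maps [g] at once. *)
Lemma top_sum_ub (R : realType) (I : finType) (l : nat) (y : I -> R) (t : R) :
    (forall i, 0 <= y i) -> (0 < l <= #|I|)%N ->
  top_sum l y <= l%:R * t + \sum_i Num.max 0 (y i - t).
Proof.
move=> y0 lI; have [T [_ [_ cT _ _ ->]]] := top_sum_attained _ _ _ _ y0 lI.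
apply: (@le_trans _ _ (l%:R * t + \sum_(i in T) Num.max 0 (y i - t))).
  rewrite mulr_natl -cT -sumr_const -big_split /=.
  by apply: ler_sum => i _; rewrite -lerBlDl le_max lexx orbT.
rewrite lerD2l [leRHS](bigID (mem T)) /= lerDl sumr_ge0 // => i _.
by rewrite le_max lexx.
Qed.

(** With [t] the threshold of [y], each [w i * y i] is at most [w i * t] plus the positive excess of
    [y i]; since [t >= 0], the mass bound then gives [l * t]. *)
Lemma top_sum_lb (R : realType) (I : finType) (l : nat) (y w : I -> R) :
    (forall i, 0 <= y i) -> (0 < l <= #|I|)%N ->
    (forall i, 0 <= w i <= 1) -> \sum_i w i <= l%:R ->
  \sum_i w i * y i <= top_sum l y.
Proof.
move=> y0 lI w01 wl.
have [T [t [t0 cT yT yN ->]]] := top_sum_attained _ _ _ _ y0 lI.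
rewrite (top_sum_threshold _ _ _ _ _ _ cT yT yN).
apply: (@le_trans _ _ ((\sum_i w i) * t + \sum_i Num.max 0 (y i - t))); last first.
  by rewrite lerD2r ler_wpM2r.
rewrite mulr_suml -big_split /=; apply: ler_sum => i _.
have /andP[wi0 wi1] := w01 i.
rewrite -lerBlDl -mulrBr.
apply: (@le_trans _ _ (w i * Num.max 0 (y i - t))).
  by rewrite ler_wpM2l // le_max lexx orbT.
by rewrite ler_piMl // le_max lexx.
Qed.

Lemma le_counting_integral (R : realType) (T : finType) (G : {set T})
    (f h : T -> R) :
  (forall g, f g <= h g) -> counting_integral G f <= counting_integral G h.
Proof.
by move=> fh; rewrite ler_wpM2r ?invr_ge0 ?ler0n //; apply: ler_sum.
Qed.

Lemma counting_integralD (R : realType) (T : finType) (G : {set T})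
    (f h : T -> R) :
  counting_integral G (fun g => f g + h g) =
  counting_integral G f + counting_integral G h.
Proof. by rewrite /counting_integral big_split mulrDl. Qed.

Lemma counting_integralZ (R : realType) (T : finType) (G : {set T})
    (r : R) (f : T -> R) :
  counting_integral G (fun g => r * f g) = r * counting_integral G f.
Proof. by rewrite /counting_integral -mulr_sumr mulrA. Qed.

Lemma counting_integral_cst (R : realType) (T : finType) (G : {set T}) (r : R) :
  G != set0 -> counting_integral G (fun=> r) = r.
Proof.
move=> G0; rewrite /counting_integral sumr_const -[X in X / _]mulr_natr mulfK //.
by rewrite pnatr_eq0 cards_eq0.
Qed.

Lemma counting_integral_sum (R : realType) (T J : finType) (G : {set T})
    (P : pred J) (f : J -> T -> R) :
  counting_integral G (fun g => \sum_(j | P j) f j g) =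
  \sum_(j | P j) counting_integral G (f j).
Proof. by rewrite /counting_integral exchange_big mulr_suml. Qed.

Lemma counting_integral_ind (R : realType) (T : finType) (G : {set T})
    (E : pred T) :
  counting_integral G (fun g => (E g)%:R) = counting_prob R G E.
Proof.
rewrite /counting_integral /counting_prob -natr_sum; congr (_%:R / _).
rewrite -sum1_card big_mkcond [in RHS]big_mkcond /=.
by apply: eq_bigr => g _; rewrite !inE; case: (g \in G); case: (E g).
Qed.

(** Moves the dependence on [g] from the summation points into indicators, whose integrals the
    hypotheses control. *)
Lemma sum_graph (R : realType) (I J : finType) (g : {ffun I -> J})
    (P : pred (I * J)) (F : I * J -> R) :
  \sum_i (P (i, g i))%:R * F (i, g i) =
  \sum_(p | P p) F p * (g p.1 == p.2)%:R.
Proof.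
pose H i j : R := (P (i, j))%:R * F (i, j) * (g i == j)%:R.
transitivity (\sum_i \sum_j H i j).
  apply: eq_bigr => i _; rewrite (bigD1 (g i)) //= /H eqxx mulr1 big1 ?addr0 //.
  by move=> j /negPf; rewrite eq_sym => ->; rewrite mulr0.
rewrite pair_bigA [RHS]big_mkcond /=; apply: eq_bigr => -[i j] _.
by rewrite /H /=; case: (P _); rewrite ?mul1r ?mul0r.
Qed.

Theorem corollary1p2 (R : realType) (n N : nat) (hn : (0 < n)%N) (hN : (0 < N)%N)
    (G : {set {ffun 'I_n -> 'I_N}}) (hG : G != set0)
    (CG : R) (hCG : 0 < CG)
    (h1 : forall (i : 'I_n) (j : 'I_N),
        counting_prob R G (fun g => g i == j) = 1 / N%:R)
    (h2 : forall (i1 i2 : 'I_n) (j1 j2 : 'I_N), (i1, j1) != (i2, j2) ->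
        counting_prob R G (fun g => (g i1 == j1) && (g i2 == j2))
          <= CG / N%:R ^+ 2)
    (a : 'M[R]_(n, N)) (l : nat) (hl : (1 <= l <= n)%N) :
  let c : R := (48 * (1 + 2 * CG) ^+ 2)^-1 in
  let C : R := 6 * (1 + 2 * CG) in
  let S : R := \sum_(1 <= j < (l * N).+1) entry_rearr a j in
  let M : R := counting_integral G (fun g =>
      \sum_(1 <= k < l.+1) kmax k (fun i : 'I_n => `|a i (g i)|)) in
  c / N%:R * S <= M /\ M <= C / N%:R * S.
Proof.
move=> c C S M.
have /andP[l0 ln] := hl.
pose A (p : 'I_n * 'I_N) : R := `|a p.1 p.2|.
have A0 p : 0 <= A p by exact: normr_ge0.
have lI : (0 < l <= #|'I_n|)%N by rewrite card_ord l0.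
have KIJ : (0 < l * N <= #|{: 'I_n * 'I_N}|)%N.
  by rewrite card_prod !card_ord muln_gt0 l0 hN leq_mul2r ln orbT.
have N0 : N%:R != 0 :> R by rewrite pnatr_eq0 -lt0n.
have Np : 0 < N%:R :> R by rewrite ltr0n.
have [T [t [t0 cT AT AN SE]]] := top_sum_attained _ _ _ _ A0 KIJ.
have {}SE : S = \sum_(p in T) A p := SE.
have S0 : 0 <= S by rewrite SE sumr_ge0.
have lR : 1 <= l%:R :> R by rewrite ler1n.
have SN0 : 0 <= S / N%:R by rewrite divr_ge0 // ltW.
have P1 p : counting_integral G (fun g => (g p.1 == p.2)%:R) = N%:R^-1 :> R.
  by rewrite counting_integral_ind h1 div1r.
split; last first.
  (* The upper bound holds with constant 1, and [C >= 1]. *)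
  have MS : M <= S / N%:R.
    have -> : S / N%:R = l%:R * t + \sum_p Num.max 0 (A p - t) * N%:R^-1.
      rewrite SE (top_sum_threshold _ _ _ _ _ _ cT AT AN) -mulr_suml natrM.
      by rewrite mulrDl mulrAC mulfK.
    apply: (@le_trans _ _ (counting_integral G (fun g =>
        l%:R * t + \sum_(p | predT p) Num.max 0 (A p - t) * (g p.1 == p.2)%:R))).
      apply: le_counting_integral => g; rewrite -sum_graph.
      under [X in _ <= _ + X]eq_bigr do rewrite mul1r.
      by apply: top_sum_ub.
    rewrite counting_integralD counting_integral_cst // counting_integral_sum lerD2l.
    by apply: ler_sum => p _; rewrite counting_integralZ P1.
  apply: le_trans MS _; rewrite /C mulrAC -mulrA.
  by rewrite ler_peMl //; lra.
pose b : R := (1 + 2 * CG)^-1.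
have bp : 0 < b by rewrite invr_gt0; lra.
have bE : b * (1 + 2 * CG) = 1 by rewrite mulVf //; lra.
have b1 : b <= 1 by nra.
pose d : R := b ^+ 2 / (4 * l%:R).
have d0 : 0 <= d by rewrite divr_ge0 ?sqr_ge0 //; lra.
have dE : d * (4 * l%:R) = b ^+ 2 by rewrite mulfVK //; lra.
pose X (g : {ffun 'I_n -> 'I_N}) : R := \sum_(q in T) (g q.1 == q.2)%:R.
have X0 g : 0 <= X g by apply: sumr_ge0 => q _; rewrite ler0n.
have lb (g : {ffun 'I_n -> 'I_N}) : \sum_(p in T) A p * (g p.1 == p.2)%:R * (b - d * X g) <=
    top_sum l (fun i : 'I_n => `|a i (g i)|).
  rewrite -mulr_suml -(sum_graph _ _ _ _ (mem T)).
  (* If the common factor is negative, the left side is at most 0 and the top sum is nonnegative;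
     otherwise the weights are admissible. *)
  have [v0|v0] := leP 0 (b - d * X g); last first.
    apply: (@le_trans _ _ 0).
      rewrite mulr_ge0_le0 ?(ltW v0) // sumr_ge0 // => i _.
      by rewrite mulr_ge0 ?ler0n.
    have [T' [? [_ _ _ _ ->]]] :=
      top_sum_attained _ _ _ _ (fun i => normr_ge0 (a i (g i))) lI.
    by apply: sumr_ge0.
  rewrite mulr_suml.
  under eq_bigr do rewrite mulrAC.
  apply: top_sum_lb => // [i|].
    rewrite /=; case: (_ \in T); rewrite ?mul1r ?mul0r ?lexx ?ler01 // v0 /=.
    by have := mulr_ge0 d0 (X0 g); lra.
  rewrite -mulr_suml.
  have -> : \sum_(i < n) ((i, g i) \in T)%:R = X g.
    have := sum_graph _ _ _ g (mem T) (fun=> 1 : R).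
    under eq_bigr do rewrite mulr1.
    by move=> ->; apply: eq_bigr => q _; rewrite mul1r.
  (* [4 l (l - b X + d X^2) = (2 l - b X)^2] *)
  have : 0 <= (2 * l%:R - b * X g) ^+ 2 by exact: sqr_ge0.
  have -> : (2 * l%:R - b * X g) ^+ 2 =
      (4 * l%:R) * (l%:R - X g * (b - d * X g)).
    transitivity (4 * l%:R ^+ 2 - 4 * l%:R * b * X g + b ^+ 2 * X g ^+ 2); first ring.
    by rewrite -dE; ring.
  by rewrite pmulr_rge0 ?subr_ge0 //; lra.
have P2 p : p \in T -> counting_integral G (fun g => (g p.1 == p.2)%:R * X g) <=
    N%:R^-1 + l%:R * CG / N%:R.
  move=> pT.
  have -> : counting_integral G (fun g => (g p.1 == p.2)%:R * X g) =
      \sum_(q in T) counting_integral G (fun g => ((g p.1 == p.2) && (g q.1 == q.2))%:R).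
    rewrite -counting_integral_sum; congr (_ / _); apply: eq_bigr => g _.
    by rewrite mulr_sumr; apply: eq_bigr => q _; rewrite -natrM mulnb.
  (* The diagonal term [q = p] has integral [1 / N]; each other term is at most [CG / N ^ 2]. *)
  rewrite (bigD1 p) //=; apply: lerD.
    by rewrite -(P1 p); apply: le_counting_integral => g; rewrite andbb.
  apply: (@le_trans _ _ (\sum_(q in T) CG / N%:R ^+ 2)).
    (* Restoring the term at [p] makes the count exactly [#|T| = l * N]. *)
    rewrite [leRHS](bigD1 p) //= ler_wpDl ?divr_ge0 ?exprn_ge0 ?(ltW hCG) ?(ltW Np) //.
    apply: ler_sum => q /andP[_ qp]; rewrite counting_integral_ind.
    by apply: h2; rewrite -!surjective_pairing eq_sym.
  by rewrite sumr_const cT -[leLHS]mulr_natl natrM le_eqVlt; apply/orP; left;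
    apply/eqP; field.
apply: (@le_trans _ _ (\sum_(p in T) A p *
    (b * N%:R^-1 - d * (N%:R^-1 + l%:R * CG / N%:R)))); last first.
  apply: (@le_trans _ _ (counting_integral G (fun g =>
      \sum_(p in T) A p * (g p.1 == p.2)%:R * (b - d * X g)))); last first.
    exact: le_counting_integral.
  rewrite counting_integral_sum; apply: ler_sum => p pT.
  have -> : counting_integral G (fun g => A p * (g p.1 == p.2)%:R * (b - d * X g)) =
      A p * (b * N%:R^-1 - d * counting_integral G (fun g => (g p.1 == p.2)%:R * X g)).
    rewrite -(P1 p) -mulNr -!counting_integralZ -counting_integralD -counting_integralZ.
    by congr (_ / _); apply: eq_bigr => g _; ring.
  by rewrite ler_wpM2l // lerD2l lerN2 ler_wpM2l // P2.
rewrite -mulr_suml -SE.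
have -> : S * (b * N%:R^-1 - d * (N%:R^-1 + l%:R * CG / N%:R)) =
    (b - d * (1 + l%:R * CG)) * (S / N%:R) by ring.
rewrite mulrAC -mulrA ler_wpM2r //.
have -> : c = b ^+ 2 / 48 by rewrite /c invfM -exprVn mulrC.
(* Uses [l >= 1] and [b * (1 + CG) <= b * (1 + 2 * CG) = 1]. The remaining factor is at least
   [3 * b / 4], which exceeds [c = b ^+ 2 / 48] because [0 < b <= 1]. *)
have dl : d * (1 + l%:R * CG) <= b / 4.
  have : d * (1 + l%:R * CG) <= d * (l%:R * (1 + CG)).
    by rewrite ler_wpM2l //; nra.
  have -> : d * (l%:R * (1 + CG)) = b ^+ 2 / 4 * (1 + CG) by rewrite -dE; field.
  by nra.
by nra.
Qed.
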